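(* Let $f_1,\dots,f_n:\mathbb{R}\to\mathbb{R}$, the weighted digraph $\mathcal{G}$ with Laplacian $\mathcal{L}\in\mathbb{R}^{n\times n}$, and the real parameters $\alpha,\beta,\gamma,\delta$ (with derived parameters $\zeta,\eta$) be as in the context, satisfying the standing assumptions listed there. Consider the system $G_m$ in feedback with $u^k=\nabla F(x^k)$ and $v^k=\mathcal{L}\hat y^k$, that is, $$\begin{aligned} w_1^{k+1} &= w_1^k-\alpha u^k-\zeta v^k,\\ \hat w_2^{k+1} &= (I-\Pi)w_1^k+(I-\Pi)\hat w_2^k-(I-\Pi)v^k,\\ x^k &= w_1^k-v^k,\\ \hat y^k &= \delta w_1^k+\eta\hat w_2^k,\\ u^k &= \nabla F(x^k),\\ v^k &= \mathcal{L}\hat y^k, \end{aligned}$$ with all signals in $\mathbb{R}^n$. Then there exists at least one fixed point $(w_1^\star,\hat w_2^\star,x^\star,\hat y^\star,u^\star,v^\star)$ of this system, and any such fixed point has $x^\star$ in the consensus subspace (the span of $\mathbb{1}$) with $x_i^\star=x_{\mathrm{opt}}$ for all $i\in\{1,\dots,n\}$; i.e., any fixed point of the system is optimal.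
   Context: Notation: $\mathbb{1}\in\mathbb{R}^n$ is the all-ones column vector, $I$ is the $n\times n$ identity, $\Pi=\frac1n\mathbb{1}\mathbb{1}^{\top}$, and $\|\cdot\|$ is the Euclidean norm of vectors and the spectral norm of matrices. The local decision variables are scalars (dimension $d=1$, taken without loss of generality). For $x=(x_1,\dots,x_n)^\top\in\mathbb{R}^n$, $\nabla F(x)=(\nabla f_1(x_1),\dots,\nabla f_n(x_n))^\top$. Graph: $\mathcal{G}=(\{1,\dots,n\},\mathcal{E})$ is a weighted digraph, where $(i,j)\in\mathcal{E}$ means node $i$ can receive information from node $j$. Its weighted Laplacian $\mathcal{L}\in\mathbb{R}^{n\times n}$ has $-\mathcal{L}_{ij}$ equal to the weight on edge $(i,j)$ if $(i,j)\in\mathcal{E}$, $\mathcal{L}_{ij}=0$ if $(i,j)\notin\mathcal{E}$ and $i\ne j$, and $\mathcal{L}_{ii}=-\sum_{j\neq i}\mathcal{L}_{ij}$, so that $\mathcal{L}\mathbb{1}=0$. Standing assumptions. (1) Each $f_i$ is convex and differentiable, and the minimizer $x_{\mathrm{opt}}=\operatorname{arg\,min}_\theta\sum_i f_i(\theta)$ is assumed to exist and be unique; it satisfies $\sum_{i=1}^n\nabla f_i(x_{\mathrm{opt}})=0$. For given constants $0<m\le L$, the local gradients are sector bounded: for all $i$ and all $x_i\in\mathbb{R}$, $$\begin{bmatrix} x_i-x_{\mathrm{opt}}\\ \nabla f_i(x_i)-\nabla f_i(x_{\mathrm{opt}})\end{bmatrix}^{\top}\begin{bmatrix}-2mL & L+m\\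 L+m & -2\end{bmatrix}\begin{bmatrix} x_i-x_{\mathrm{opt}}\\ \nabla f_i(x_i)-\nabla f_i(x_{\mathrm{opt}})\end{bmatrix}\ge 0 .$$ (2) $\mathcal{G}$ is strongly connected. (3) $\mathcal{G}$ is weight balanced: $\mathbb{1}^{\top}\mathcal{L}=0$. (4) $\sigma:=\|I-\Pi-\mathcal{L}\|<1$. Parameters: $\alpha,\beta,\gamma,\delta\in\mathbb{R}$ with $\gamma^2\ge 4\beta\delta$. Define $\zeta=\beta/\gamma$ if $\delta=0$ and $\zeta=\frac{\gamma-\sqrt{\gamma^2-4\beta\delta}}{2\delta}$ otherwise, and $\eta=\gamma-\delta\zeta$. A fixed point is a tuple $(w_1^\star,\hat w_2^\star,x^\star,\hat y^\star,u^\star,v^\star)$ of vectors in $\mathbb{R}^n$ satisfying all six equations of the system when every time-indexed signal (at times $k$ and $k+1$) is replaced by its starred value.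
   Formalization: Added conditions, without which the claim fails: γ ≠ 0 when δ = 0 (else ζ = β/γ is undefined), β ≠ 0 for the existence of a fixed point, and α ≠ 0 for the optimality of every fixed point. *)

(* Defs.v *)
From HB Require Import structures.
From mathcomp Require Import all_boot all_order all_algebra.
From mathcomp Require Import all_classical all_reals all_analysis.

Set Implicit Arguments.
Unset Strict Implicit.
Unset Printing Implicit Defensive.

Import Order.TTheory GRing.Theory Num.Theory.
Import numFieldNormedType.Exports.

Local Open Scope classical_set_scope.
Local Open Scope ring_scope.

(* The Euclidean norm: the library's norm on matrices is the max norm. *)
Definition norm2 (R : realType) (n : nat) (x : 'cV[R]_n) : R :=
  Num.sqrt (\sum_(i < n) x i 0 ^+ 2).

Definition spectral_norm (R : realType) (n : nat) (A : 'M[R]_n) : R :=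
  sup [set norm2 (A *m x) | x in [set x : 'cV[R]_n | norm2 x <= 1]].

Definition ones (R : realType) (n : nat) : 'cV[R]_n := const_mx 1.

Definition avg_mx (R : realType) (n : nat) : 'M[R]_n :=
  n%:R^-1 *: (ones R n *m (ones R n)^T).

(* [edge G i j] means that node [i] can receive information from node [j].
   The sign of the weights is unrestricted. *)
Record wdigraph (R : realType) (n : nat) := WDigraph {
  edge : rel 'I_n;
  weight : 'I_n -> 'I_n -> R }.

(* Weights off the edge set and self-loops do not contribute. *)
Definition laplacian (R : realType) (n : nat) (G : wdigraph R n) : 'M[R]_n :=
  let offdiag i j := if edge G i j then - weight G i j else 0 in
  \matrix_(i, j) (if i == j then - \sum_(k < n | k != i) offdiag i k
                  else offdiag i j).

Definition strongly_connected (R : realType) (n : nat) (G : wdigraph R n) :=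
  forall i j : 'I_n, connect (edge G) i j.

Definition weight_balanced (R : realType) (n : nat) (G : wdigraph R n) :=
  (ones R n)^T *m laplacian G = 0.

Definition minimizer (R : realType) (g : R -> R) (x : R) :=
  forall y, g x <= g y.

Definition sector_bounded (R : realType) (m L : R) (g : R -> R) (xopt : R) :=
  let M : 'M[R]_(1 + 1) :=
    block_mx (- 2 * m * L)%:M (L + m)%:M
             (L + m)%:M       (- 2)%:M in
  forall x : R,
    let z : 'cV[R]_(1 + 1) := col_mx (x - xopt)%:M (g x - g xopt)%:M in
    0 <= (z^T *m M *m z) 0 0.

Definition gradF (R : realType) (n : nat) (f : 'I_n -> R -> R)
    (x : 'cV[R]_n) : 'cV[R]_n :=
  \col_i derive1 (f i) (x i 0).

(* Division by 0 is total: when delta = 0 this is meaningful only for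
   gamma != 0. *)
Definition zeta (R : realType) (beta gamma delta : R) : R :=
  if delta == 0 then beta / gamma
  else (gamma - Num.sqrt (gamma ^+ 2 - 4 * beta * delta)) / (2 * delta).

Definition eta (R : realType) (beta gamma delta : R) : R :=
  gamma - delta * zeta beta gamma delta.

(* The values of all signals of the closed loop at one time instant. *)
Record signals (R : realType) (n : nat) := Signals {
  sig_w1 : 'cV[R]_n;
  sig_w2 : 'cV[R]_n;
  sig_x : 'cV[R]_n;
  sig_y : 'cV[R]_n;
  sig_u : 'cV[R]_n;
  sig_v : 'cV[R]_n }.

(* [Gm_system ... s s'] are the equations of G_m in feedback with gradF and
   the Laplacian, with [s] the signals at time k and [s'] those at time k+1. *)
Definition Gm_system (R : realType) (n : nat) (f : 'I_n -> R -> R)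
    (G : wdigraph R n) (alpha beta gamma delta : R) (s s' : signals R n) :=
  let P := 1%:M - avg_mx R n in
  [/\ sig_w1 s' = sig_w1 s - alpha *: sig_u s
                  - zeta beta gamma delta *: sig_v s,
      sig_w2 s' = P *m sig_w1 s + P *m sig_w2 s - P *m sig_v s,
      sig_x s = sig_w1 s - sig_v s,
      sig_y s = delta *: sig_w1 s + eta beta gamma delta *: sig_w2 s &
      sig_u s = gradF f (sig_x s) /\ sig_v s = laplacian G *m sig_y s].

Definition fixed_point (R : realType) (n : nat) (f : 'I_n -> R -> R)
    (G : wdigraph R n) (alpha beta gamma delta : R) (s : signals R n) :=
  Gm_system f G alpha beta gamma delta s s.

Definition consensus (R : realType) (n : nat) (x : 'cV[R]_n) :=
  exists c : R, x = c *: ones R n.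

(* Main.v *)
Require Import Defs.
From HB Require Import structures.
From mathcomp Require Import all_boot all_order all_algebra.
From mathcomp Require Import all_classical all_reals all_analysis.
From mathcomp Require Import ring lra.

Set Implicit Arguments.
Unset Strict Implicit.
Unset Printing Implicit Defensive.

Import Order.TTheory GRing.Theory Num.Theory.
Import numFieldNormedType.Exports.

Local Open Scope classical_set_scope.
Local Open Scope ring_scope.

(** Write Pi for the averaging matrix, P = I - Pi and Lap for the Laplacian.

    Optimality.  At a fixed point the second equation reads P x = Pi w2, and
    since the ranges of P and Pi are complementary, both sides vanish: x is
    a consensus vector c * 1 (and w2 has zero mean).  The first equation
    reads alpha u + zeta v = 0.  Weight balance gives 1^T v = 1^T Lap y = 0,
    so when alpha != 0 the gradients f_i'(c) sum to zero.  The gradients at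
    xopt also sum to zero (Fermat), and adding up the n sector inequalities at
    the common point c gives 0 <= - m L n (c - xopt)^2, whence c = xopt
    ([sector_root_unique]).

    Existence.  Take x = xopt * 1 and u = gradF x; the first equation then
    dictates v = - (alpha / zeta) u, and the third one w1 = x + v.  What is
    missing is a zero-mean w2 with v = Lap (delta w1 + eta w2).  As sigma < 1,
    the matrix Lap + Pi = I - (I - Pi - Lap) is invertible
    ([spectral_norm_lt1_unit]), so the zero-mean vector v is Lap z for a
    zero-mean z ([laplacian_solve]); then w2 = (z - delta v) / eta works
    because Lap kills constants.  The divisions by zeta and eta are legitimate
    because zeta is a root of delta t^2 - gamma t + beta, i.e. zeta * eta = beta
    ([zeta_mul_eta]), which is nonzero. *)

(** * Euclidean and spectral norms *)

Section Norms.
Variables (R : realType) (n : nat).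
Implicit Types (x y : 'cV[R]_n) (A : 'M[R]_n).

Lemma norm2_eq0 x : norm2 x = 0 -> x = 0.
Proof.
move/eqP; rewrite sqrtr_eq0 => le0.
have ge0 : 0 <= \sum_(i < n) x i 0 ^+ 2.
  by apply: sumr_ge0 => i _; exact: sqr_ge0.
have /eqP sum0 : \sum_(i < n) x i 0 ^+ 2 == 0 by rewrite eq_le le0 ge0.
apply/colP => i; rewrite mxE; apply/eqP; rewrite -sqrf_eq0; apply/eqP.
by apply: (psumr_eq0P _ sum0) => // j _; exact: sqr_ge0.
Qed.

Lemma norm2Z a x : norm2 (a *: x) = `|a| * norm2 x.
Proof.
rewrite /norm2 (eq_bigr (fun i => a ^+ 2 * x i 0 ^+ 2)); last first.
  by move=> i _; rewrite mxE exprMn.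
by rewrite -mulr_sumr sqrtrM ?sqr_ge0// sqrtr_sqr.
Qed.

Lemma norm2_le x y : (forall i, `|x i 0| <= y i 0) -> norm2 x <= norm2 y.
Proof.
move=> lexy; apply/ler_wsqrtr/ler_sum => i _.
by rewrite -[leLHS]real_normK ?num_real// lerXn2r// nnegrE (le_trans _ (lexy i)).
Qed.

Lemma norm2_coord x i : `|x i 0| <= norm2 x.
Proof.
rewrite -sqrtr_sqr; apply: ler_wsqrtr; rewrite (bigD1 i)//= lerDl.
by apply: sumr_ge0 => j _; exact: sqr_ge0.
Qed.

(** The supremum in the definition of [spectral_norm] is a genuine one because
    the image of the unit ball is bounded: entries of [A *m x] are at most the
    absolute row sums of [A]. *)
Lemma norm2_mulmx_le A x : norm2 x <= 1 -> norm2 (A *m x) <= spectral_norm A.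
Proof.
move=> x1; apply: ub_le_sup; last by exists x.
exists (norm2 (\col_i \sum_j `|A i j|)) => _ [z /= z1 <-].
apply: norm2_le => i; rewrite !mxE; apply: le_trans (ler_norm_sum _ _ _) _.
apply: ler_sum => j _; rewrite normrM ler_piMr//.
exact: le_trans (norm2_coord z j) z1.
Qed.

(** A matrix of spectral norm less than 1 cannot fix a unit vector, so [I - A]
    has trivial kernel. *)
Lemma spectral_norm_lt1_unit A : spectral_norm A < 1 -> 1%:M - A \in unitmx.
Proof.
move=> A1; rewrite -unitmx_tr -row_free_unit -kermx_eq0.
apply/rowV0P => r /sub_kermxP rK.
have : (1%:M - A) *m r^T = 0 by apply: trmx_inj; rewrite trmx_mul trmxK trmx0.
rewrite mulmxBl mul1mx => /subr0_eq Ax.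
suff x0 : r^T = 0 by rewrite -[r]trmxK x0 trmx0.
move: r^T Ax => x Ax.
apply: norm2_eq0; apply: contraTeq A1 => x0; rewrite -leNgt.
have unit_x : norm2 ((norm2 x)^-1 *: x) = 1.
  by rewrite norm2Z ger0_norm ?invr_ge0 ?sqrtr_ge0// mulVf.
have := norm2_mulmx_le A (_ : norm2 ((norm2 x)^-1 *: x) <= 1).
by rewrite -scalemxAr -Ax unit_x => ->.
Qed.

End Norms.

(** * Averaging and the Laplacian *)

Section Averaging.
Variables (R : realType) (n : nat).
Implicit Types (x : 'cV[R]_n) (G : wdigraph R n).

Lemma ones_mulmx x : (ones R n)^T *m x = (\sum_i x i 0)%:M.
Proof.
apply/rowP => i; rewrite !mxE ord1 eqxx mulr1n.
by apply: eq_bigr => j _; rewrite !mxE mul1r.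
Qed.

Lemma avg_mulmx x : avg_mx R n *m x = (n%:R^-1 * \sum_i x i 0) *: ones R n.
Proof.
by rewrite -scalemxAl -mulmxA ones_mulmx mul_mx_scalar scalerA.
Qed.

Lemma ones_avg : (ones R n)^T *m avg_mx R n = (ones R n)^T.
Proof.
rewrite -scalemxAr mulmxA ones_mulmx mul_scalar_mx scalerA.
under eq_bigr do rewrite mxE.
rewrite sumr_const card_ord; apply/rowP => i.
have n_gt0 : (0 < n)%N by exact: leq_trans (ltn_ord i).
by rewrite mulVf ?pnatr_eq0 -?lt0n// scale1r.
Qed.

Lemma avg_idem : avg_mx R n *m avg_mx R n = avg_mx R n.
Proof. by rewrite {1 3}/avg_mx -scalemxAl -mulmxA ones_avg. Qed.

Lemma avg_ones : avg_mx R n *m ones R n = ones R n.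
Proof.
by apply: trmx_inj; rewrite trmx_mul -[in RHS]ones_avg linearZ/= trmx_mul trmxK.
Qed.

Lemma laplacian_ones G : laplacian G *m ones R n = 0.
Proof.
apply/colP => i; rewrite !mxE (bigD1 i)//= !mxE eqxx mulr1.
apply/eqP; rewrite addrC subr_eq0; apply/eqP; apply: eq_bigr => j ji.
by rewrite !mxE mulr1 eq_sym (negPf ji).
Qed.

(** For a weight-balanced graph the Laplacian maps zero-mean vectors to
    zero-mean vectors.  The norm bound makes it onto them: adding the averaging
    matrix, which vanishes on zero-mean vectors, makes it invertible, and the
    sum still preserves the mean. *)
Lemma laplacian_solve G (v : 'cV[R]_n) : weight_balanced G ->
  spectral_norm (1%:M - avg_mx R n - laplacian G) < 1 ->
  (ones R n)^T *m v = 0 ->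
  exists2 z : 'cV[R]_n, laplacian G *m z = v & avg_mx R n *m z = 0.
Proof.
move=> bal /spectral_norm_lt1_unit; rewrite -addrA opprD addNKr -opprD opprK.
set M := avg_mx R n + _ => uM v0; pose z := invmx M *m v.
have Mz : M *m z = v by rewrite /z mulKVmx.
have z0 : avg_mx R n *m z = 0.
  rewrite -scalemxAl -mulmxA -[(ones R n)^T]addr0 -bal -{1}ones_avg -mulmxDr.
  by rewrite -mulmxA Mz v0 mulmx0 scaler0.
by exists z; rewrite // -Mz mulmxDl z0 add0r.
Qed.

End Averaging.

(** * The scalar parameters and the gradients *)

Lemma zeta_mul_eta (R : realType) (beta gamma delta : R) :
  4 * beta * delta <= gamma ^+ 2 -> (delta = 0 -> gamma != 0) ->
  zeta beta gamma delta * Defs.eta beta gamma delta = beta.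
Proof.
move=> disc gamma0; rewrite /Defs.eta /zeta; have [d0|d0] := eqVneq delta 0.
  by rewrite d0 mul0r subr0 divfK// gamma0.
have := sqr_sqrtr (_ : 0 <= gamma ^+ 2 - 4 * beta * delta).
rewrite subr_ge0 => /(_ disc); set q := Num.sqrt _ => q2.
have -> : gamma - delta * ((gamma - q) / (2 * delta)) = (gamma + q) / 2 by field.
have -> : (gamma - q) / (2 * delta) * ((gamma + q) / 2)
          = (gamma ^+ 2 - q ^+ 2) / (4 * delta) by field.
by rewrite q2; field.
Qed.

Section Gradients.
Variables (R : realType) (n : nat).

Lemma minimizer_sum_derive (f : 'I_n -> R -> R) (xopt : R) :
  (forall i x, derivable (f i) x 1) ->
  minimizer (fun t => \sum_(i < n) f i t) xopt ->
  \sum_(i < n) derive1 (f i) xopt = 0.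
Proof.
move=> fd fmin; pose g := \sum_(i < n) f i.
have gE t : g t = \sum_(i < n) f i t by rewrite /g fct_sumE.
have gd t : derivable g t 1 by apply: derivable_sum.
have [||||_ Dg] := @derive1_at_min R g (xopt - 1) (xopt + 1) xopt.
- by lra.
- by move=> t _; exact: gd.
- by rewrite in_itv/=; lra.
- by move=> t _; rewrite !gE; exact: fmin.
by rewrite -[RHS]Dg derive_sum//; apply: eq_bigr => i _; rewrite derive1E.
Qed.

Lemma sector_boundedE (m L : R) (g : R -> R) (xopt x : R) :
  sector_bounded m L g xopt ->
  m * L * (x - xopt) ^+ 2 + (g x - g xopt) ^+ 2
    <= (L + m) * (x - xopt) * (g x - g xopt).
Proof.
move=> /(_ x) /=; rewrite tr_col_mx mul_row_block mul_row_col.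
rewrite !tr_scalar_mx -!scalar_mxM -!raddfD/= -!scalar_mxM -raddfD/=.
rewrite !mxE mulr1n => h.
set d := x - xopt in h *; set e := g x - g xopt in h *; nra.
Qed.

(** The deviations of the gradients between [xopt] and [c] sum to zero, so the
    cross terms of the summed sector inequalities cancel and only the negative
    definite part is left. *)
Lemma sector_root_unique (m L : R) (g : 'I_n -> R -> R) (xopt c : R) :
  (0 < n)%N -> 0 < m -> m <= L ->
  (forall i, sector_bounded m L (g i) xopt) ->
  \sum_i g i xopt = 0 -> \sum_i g i c = 0 -> c = xopt.
Proof.
move=> n0 m0 mL sec sopt sc.
have : \sum_(i < n) m * L * (c - xopt) ^+ 2 <=
       \sum_i (L + m) * (c - xopt) * (g i c - g i xopt).
  apply: ler_sum => i _; apply: le_trans (sector_boundedE c (sec i)).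
  by rewrite lerDl sqr_ge0.
rewrite -mulr_sumr sumrB sc sopt subr0 mulr0 sumr_const card_ord.
rewrite pmulrn_lle0// pmulr_rle0 ?mulr_gt0 ?(lt_le_trans m0)// => le0.
apply/eqP; rewrite -subr_eq0 -sqrf_eq0.
by rewrite eq_le le0 sqr_ge0.
Qed.

End Gradients.

(** * Fixed points of the closed loop *)

Section FixedPoints.
Variables (R : realType) (n : nat) (f : 'I_n -> R -> R) (G : wdigraph R n).
Variables (alpha beta gamma delta : R).

Lemma fixed_point_consensus s : fixed_point f G alpha beta gamma delta s ->
  consensus (sig_x s).
Proof.
case=> _; set P := 1%:M - _ => w2E xE _ _.
have PxE : P *m sig_x s = avg_mx R n *m sig_w2 s.
  apply: (addrI (P *m sig_w2 s)); rewrite -mulmxDl subrK mul1mx [RHS]w2E.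
  by rewrite xE mulmxBr addrA [P *m _ + P *m _]addrC.
have w20 : avg_mx R n *m sig_w2 s = 0.
  rewrite -avg_idem -mulmxA -PxE mulmxA mulmxBr mulmx1 avg_idem subrr.
  by rewrite mul0mx.
exists (n%:R^-1 * \sum_i sig_x s i 0); rewrite -avg_mulmx.
by apply/subr0_eq; rewrite -{1}[sig_x s]mul1mx -mulmxBl PxE.
Qed.

(** The Laplacian term has zero mean, so the mean of [w1] is driven by the
    gradients alone; it is stationary only if they balance. *)
Lemma fixed_point_sum_gradient s : alpha != 0 -> weight_balanced G ->
  fixed_point f G alpha beta gamma delta s ->
  \sum_i derive1 (f i) (sig_x s i 0) = 0.
Proof.
move=> alpha0 bal [w1E _ _ _ [uE vE]].
have auE : alpha *: sig_u s = - (zeta beta gamma delta *: sig_v s).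
  apply/eqP; rewrite -addr_eq0; apply/eqP/oppr_inj.
  by apply: (addrI (sig_w1 s)); rewrite oppr0 addr0 opprD addrA -w1E.
have v0 : (ones R n)^T *m sig_v s = 0 by rewrite vE mulmxA bal mul0mx.
have : (ones R n)^T *m sig_u s = 0.
  apply: (scalerI alpha0); rewrite scaler0 scalemxAr auE mulmxN -scalemxAr v0.
  by rewrite scaler0 oppr0.
rewrite ones_mulmx => /matrixP/(_ 0 0); rewrite !mxE eqxx mulr1n => u0.
by rewrite -[RHS]u0; apply: eq_bigr => i _; rewrite uE mxE.
Qed.

Lemma fixed_point_exists c : weight_balanced G ->
  spectral_norm (1%:M - avg_mx R n - laplacian G) < 1 ->
  zeta beta gamma delta != 0 -> Defs.eta beta gamma delta != 0 ->
  \sum_i derive1 (f i) c = 0 ->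
  exists s, fixed_point f G alpha beta gamma delta s.
Proof.
set Z := zeta _ _ _; set E := Defs.eta _ _ _ => bal sig Z0 E0 sc.
pose x := c *: ones R n; pose u := gradF f x; pose v := - (alpha / Z) *: u.
have u0 : (ones R n)^T *m u = 0.
  rewrite ones_mulmx (_ : \sum_i u i 0 = 0) ?raddf0// -[RHS]sc.
  by apply: eq_bigr => i _; rewrite !mxE mulr1.
have v0 : (ones R n)^T *m v = 0 by rewrite -scalemxAr u0 scaler0.
have avg_v : avg_mx R n *m v = 0.
  by rewrite -scalemxAl -mulmxA v0 mulmx0 scaler0.
have [z Lz avg_z] := laplacian_solve bal sig v0.
pose w2 := E^-1 *: (z - delta *: v).
have avg_w2 : avg_mx R n *m w2 = 0.
  by rewrite -scalemxAr mulmxBr -scalemxAr avg_z avg_v scaler0 subr0 scaler0.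
exists (Signals (x + v) w2 x (delta *: (x + v) + E *: w2) u v).
split=> /=; rewrite -/Z -/E //.
- have -> : Z *: v = - (alpha *: u).
    by rewrite /v scalerA mulrN mulrCA mulfV// mulr1 scaleNr.
  by rewrite opprK subrK.
- rewrite addrAC -mulmxBr addrK mulmxBl mul1mx -scalemxAr avg_ones subrr add0r.
  by rewrite mulmxBl mul1mx avg_w2 subr0.
- by rewrite addrK.
split=> //; rewrite /w2 scalerA mulfV// scale1r scalerDr addrACA subrr.
by rewrite addr0 mulmxDr -!scalemxAr laplacian_ones !scaler0 add0r Lz.
Qed.

End FixedPoints.

Theorem theorem1 (R : realType) (n : nat) (f : 'I_n -> R -> R)
    (xopt m L : R) (G : wdigraph R n) (alpha beta gamma delta : R)
    (f_convex : forall i, convex_function setT (f i))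
    (f_diff : forall i (x : R), derivable (f i) x 1)
    (xopt_min : unique (minimizer (fun t => \sum_(i < n) f i t)) xopt)
    (m_gt0 : 0 < m) (m_le_L : m <= L)
    (f_sector : forall i, sector_bounded m L (derive1 (f i)) xopt)
    (G_conn : strongly_connected G)
    (G_bal : weight_balanced G)
    (sigma_lt1 : spectral_norm (1%:M - avg_mx R n - laplacian G) < 1)
    (discr_ge0 : gamma ^+ 2 >= 4 * beta * delta)
    (zeta_def : delta = 0 -> gamma != 0) :
  (beta != 0 -> exists s, fixed_point f G alpha beta gamma delta s) /\
  (alpha != 0 -> forall s, fixed_point f G alpha beta gamma delta s ->
     consensus (sig_x s) /\ forall i, sig_x s i 0 = xopt).
Proof.
have sopt := minimizer_sum_derive f_diff xopt_min.1.
split=> [beta0 | alpha0 s fp].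
  have /andP[Z0 E0] :
      (zeta beta gamma delta != 0) && (Defs.eta beta gamma delta != 0).
    by rewrite -negb_or -mulf_eq0 zeta_mul_eta.
  exact: fixed_point_exists G_bal sigma_lt1 Z0 E0 sopt.
have cons := fixed_point_consensus fp; split=> // i.
have [c xE] := cons; have xj j : sig_x s j 0 = c by rewrite xE !mxE mulr1.
have := fixed_point_sum_gradient alpha0 G_bal fp.
under eq_bigr do rewrite xj.
rewrite xj; apply: sector_root_unique m_gt0 m_le_L f_sector sopt.
exact: leq_trans (ltn_ord i).
Qed.
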